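(* Any five points in $\mathbb{TP}^2$ lie on a tropical conic. The conic is unique if and only if the five points do not lie on a common tropical curve whose support is a proper subset of $\mathcal{A}=\{(2,0,0),(1,1,0),(0,2,0),(0,1,1),(0,0,2),(1,0,1)\}$.
   Context: $\mathbb{TP}^{m-1}=\mathbb{R}^m/\mathbb{R}(1,\dots,1)$. For a finite set $\mathcal{B}\subset\mathbb{N}_0^3$ of exponent vectors with constant coordinate sum and real coefficients $(a_{ijk})_{(i,j,k)\in\mathcal{B}}$, the tropical curve with support $\mathcal{B}$ and these coefficients is the set of points $(x,y,z)\in\mathbb{TP}^2$ at which $\min_{(i,j,k)\in\mathcal{B}}(a_{ijk}+ix+jy+kz)$ is attained at least twice. A tropical conic is a tropical curve with support equal to $\mathcal{A}$; conics are identified with their coefficient vectors $a=(a_1,\dots,a_6)\in\mathbb{TP}^5$ (all coefficients real), and uniqueness of the conic means uniqueness of this vector in $\mathbb{TP}^5$. *)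

(* Defs.v *)
From mathcomp Require Import all_boot all_order all_algebra.
From mathcomp Require Import generic_quotient ring_quotient finmap reals.

Set Implicit Arguments.
Unset Strict Implicit.
Unset Printing Implicit Defensive.

Import Order.TTheory GRing.Theory Num.Theory.
Local Open Scope ring_scope.
Local Open Scope quotient_scope.

Section TropicalProjectiveSpace.
Variable R : realType.

Definition TP (m : nat) : Type :=
  Quotient.quot <[const_mx 1 : 'rV[R]_m.+1]>%VS.

Definition TPclass m (u : 'rV[R]_m.+1) : TP m := \pi u.
Definition TPrepr m (p : TP m) : 'rV[R]_m.+1 := repr p.

Lemma TPreprK m (p : TP m) : TPclass (TPrepr p) = p.
Proof. exact: reprK. Qed.

Lemma TPclass_eqP m (u v : 'rV[R]_m.+1) :
  TPclass u = TPclass v <-> exists c : R, u = v + const_mx c.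
Proof.
split=> [/eqP|[c ->]].
  rewrite -Quotient.idealrBE => /vlineP[c uv]; exists c.
  by rewrite -[u](subrK v) uv scalemx_const mulr1 addrC.
apply/eqP; rewrite -Quotient.idealrBE; apply/vlineP; exists c.
by rewrite scalemx_const mulr1 addrAC subrr add0r.
Qed.

End TropicalProjectiveSpace.

Notation exponent := (3.-tuple nat).

Definition homogeneous (B : {fset exponent}) : Prop :=
  exists d : nat, {in B, forall e : exponent, (\sum_(k < 3) tnth e k)%N = d}.

Section TropicalCurves.
Variable R : realType.

Definition tropical_monomial (a : R) (e : exponent) (u : 'rV[R]_3) : R :=
  a + \sum_(k < 3) (tnth e k)%:R * u 0 k.

Definition argmin_terms (B : {fset exponent}) (b : B -> R)
    (u : 'rV[R]_3) : {set B} :=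
  [set e : B | [forall f : B,
    tropical_monomial (b e) (val e) u <= tropical_monomial (b f) (val f) u]].

Definition min_attained_twice (B : {fset exponent}) (b : B -> R)
  (u : 'rV[R]_3) : bool := (2 <= #|argmin_terms b u|)%N.

(* Only meaningful for a homogeneous support B: the choice of a
   representative is then irrelevant, see tropical_curve_class. *)
Definition tropical_curve (B : {fset exponent}) (b : B -> R)
  : {pred TP R 2} := [pred p | min_attained_twice b (TPrepr p)].

Lemma tropical_monomialD (a c : R) (e : exponent) (u : 'rV[R]_3) :
  tropical_monomial a e (u + const_mx c) =
  tropical_monomial a e u + (\sum_(k < 3) tnth e k)%N%:R * c.
Proof.
rewrite /tropical_monomial -addrA; congr (_ + _).
rewrite natr_sum mulr_suml -big_split /=.
by apply: eq_bigr => k _; rewrite !mxE mulrDr.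
Qed.

Lemma tropical_curve_class (B : {fset exponent}) (b : B -> R) u :
  homogeneous B -> (TPclass u \in tropical_curve b) = min_attained_twice b u.
Proof.
move=> [d Bd]; have /TPclass_eqP[c uE] := TPreprK (TPclass u).
rewrite inE uE /min_attained_twice; congr (1 < _)%N.
apply: eq_card => e; rewrite !inE; apply: eq_forallb => f.
by rewrite !tropical_monomialD !Bd ?fsvalP // lerD2r.
Qed.

(* The list fixes the order of the coefficients a_1, ..., a_6 of a conic. *)
Definition conic_exponents : 6.-tuple exponent :=
  [tuple [tuple 2; 0; 0]%N; [tuple 1; 1; 0]%N; [tuple 0; 2; 0]%N;
         [tuple 0; 1; 1]%N; [tuple 0; 0; 2]%N; [tuple 1; 0; 1]%N].

Definition conic_support : {fset exponent} :=
  [fset e in (conic_exponents : seq exponent)]%fset.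

Lemma in_conic_support (e : exponent) :
  (e \in conic_support) = (e \in (conic_exponents : seq exponent)).
Proof. by apply: (in_fset imfset_key). Qed.

Lemma conic_indexP (e : conic_support) : (index (val e) conic_exponents < 6)%N.
Proof. by have := fsvalP e; rewrite in_conic_support -index_mem. Qed.

Definition conic_coef (a : 'rV[R]_6) (e : conic_support) : R :=
  a 0 (Ordinal (conic_indexP e)).

Definition tropical_conic (a : TP R 5) : {pred TP R 2} :=
  tropical_curve (conic_coef (TPrepr a)).

End TropicalCurves.

Lemma homogeneous_conic_support : homogeneous conic_support.
Proof.
exists 2%N => e; rewrite in_conic_support !inE => /or4P[|||/or3P[||]] /eqP->;
  by rewrite !big_ord_recl big_ord0.
Qed.

Lemma homogeneousS (B C : {fset exponent}) :
  (B `<=` C)%fset -> homogeneous C -> homogeneous B.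
Proof. by move=> /fsubsetP BC [d Cd]; exists d => e /BC /Cd. Qed.

Lemma tropical_conic_class (R : realType) (a : 'rV[R]_6) (u : 'rV[R]_3) :
  (TPclass u \in tropical_conic (TPclass a)) =
  min_attained_twice (conic_coef a) u.
Proof.
rewrite tropical_curve_class; last exact: homogeneous_conic_support.
have /TPclass_eqP[c aE] := TPreprK (TPclass a).
rewrite /min_attained_twice; congr (1 < _)%N.
apply: eq_card => e; rewrite !inE; apply: eq_forallb => f.
by rewrite /tropical_monomial /conic_coef aE !mxE ![_ + c + _]addrAC lerD2r.
Qed.

(* Main.v *)
Require Import Defs.
From mathcomp Require Import all_boot all_order all_algebra.
From mathcomp Require Import finmap reals.
From mathcomp Require Import all_fingroup lra.

(** Index the rows of a square matrix by the five points and one dummy row [r],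
    and its columns by the monomials; a conic through the points is a vector [x]
    such that [min_j (x j + N i j)] is attained twice for every row [i != r].
    The maximal tropical minors of the other rows form such a vector (tropical
    Cramer rule), because exchanging two rows turns an optimal permutation into
    a second one.  The same trick inside a singular minor, started at a row where
    two optimal permutations differ, yields a solution with one monomial fewer.
    If instead all maximal minors are nonsingular, then rerouting an optimal
    permutation through the second minimizers of a solution [x] shows that [x]
    differs from the Cramer vector by a constant.  Finally, a solution on fewer
    monomials extends to a full one by any sufficiently large coefficients. *)

Set Implicit Arguments.
Unset Strict Implicit.
Unset Printing Implicit Defensive.

Import Order.TTheory GRing.Theory Num.Theory.

(** * Tropical kernels of square matrices with one dummy row *)

Section TropicalKernel.
Local Open Scope ring_scope.
Variables (R : realFieldType) (T : finType).

Definition attained_twice (S : {set T}) (f : T -> R) : Prop :=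
  exists j k : T, [/\ j \in S, k \in S, j != k,
    forall l, l \in S -> f j <= f l & forall l, l \in S -> f k <= f l].

(** Let [x l] be the least [c u] over the fiber [g u = l]; then [g] maps minimizers of
    [c u + f (g u)] to minimizers of [x l + f l]. As [x] is chosen before [f], one vector serves all
    rows. *)
Lemma attained_twice_fibers (F : finType) (P : pred F) (g : F -> T)
    (c : F -> R) :
  exists x : T -> R, forall (f : T -> R) (s t : F),
    P s -> P t -> g s != g t ->
    (forall u, P u -> c s + f (g s) <= c u + f (g u)) ->
    (forall u, P u -> c t + f (g t) <= c u + f (g u)) ->
    attained_twice [set g u | u in P] (fun l => x l + f l).
Proof.
have /fin_all_exists[x xP] : forall l, exists y, forall u, P u -> g u = l ->
    y <= c u /\ exists v, [/\ P v, g v = l & y = c v].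
  move=> l; case: (pickP [pred u | P u && (g u == l)]) => [u0 u0P|no_u]; last first.
    (* An empty fiber gets the default 0; its index lies outside the image of [P]. *)
    by exists 0 => u Pu gu; have := no_u u; rewrite /= Pu gu eqxx.
  case: (arg_minP c u0P) => v /= /andP[Pv /eqP gv] v_min.
  exists (c v) => u Pu gu; split; last by exists v.
  by apply: v_min; rewrite Pu gu eqxx.
have x_min f s : P s ->
    (forall u, P u -> c s + f (g s) <= c u + f (g u)) ->
    forall l, l \in [set g u | u in P] -> x (g s) + f (g s) <= x l + f l.
  move=> Ps s_min l /imsetP[u Pu ->].
  have [_ [v [Pv gv ->]]] := xP _ u Pu erefl.
  have [xs _] := xP _ s Ps erefl.
  by apply: le_trans (_ : c s + f (g s) <= _); rewrite ?lerD2r // -gv s_min.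
exists x => f s t Ps Pt gst s_min t_min; exists (g s), (g t).
by split; rewrite ?imset_f //; apply: x_min.
Qed.

Lemma perm_of_fun (h : T -> T) (x0 : T) :
  exists (O : {set T}) (s : {perm T}), O != set0 /\
    forall x, s x = if x \in O then h x else x.
Proof.
(* A map is injective on a minimal nonempty set that it maps into itself. *)
pose closed (A : {set T}) := (A != set0) && (h @: A \subset A).
have [|O Omin] := @ex_minset _ closed.
  by exists setT; rewrite /closed subsetT andbT; apply/set0Pn; exists x0.
have /andP[O0 hO] := minsetp Omin.
have hOE : h @: O = O.
  apply: (minsetinf Omin) => //; apply/andP; split; last exact: imsetS.
  by case/set0Pn: O0 => x Ox; apply/set0Pn; exists (h x); apply: imset_f.
have h_inj : {in O &, injective h} by apply/imset_injP; rewrite hOE.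
have s_inj : injective (fun x => if x \in O then h x else x).
  move=> x y; have hx z : z \in O -> h z \in O by move=> Oz; rewrite -{1}hOE imset_f.
  case: ifP => Ox; case: ifP => Oy //; first exact: h_inj.
    by move=> hxy; rewrite -hxy hx in Oy.
  by move=> hxy; rewrite hxy hx in Ox.
by exists O, (perm s_inj); split=> // x; rewrite permE.
Qed.

Variables (N : T -> T -> R) (r : T).

Definition kernel_vector (S : {set T}) (x : T -> R) : Prop :=
  forall i, i != r -> attained_twice S (fun l => x l + N i l).

(** Minimizing over all [s] with [s r = j] gives the tropical minor without row [r] and column
    [j]. *)
Definition cost (s : {perm T}) : R := \sum_(i | i != r) N i (s i).

(** Both sides are costs in the matrix whose row [i0] is replaced by a copy of row [i]; swapping
    equal rows changes nothing. *)
Lemma tperm_cost (i0 i : T) (s : {perm T}) : i != r -> i != i0 ->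
  let t := (tperm i i0 * s)%g in
  \sum_(k | (k != r) && (k != i0)) N k (t k) + N i (t i0) =
  \sum_(k | (k != r) && (k != i0)) N k (s k) + N i (s i0).
Proof.
move=> ir ii0 t.
have ti : t i = s i0 by rewrite permM tpermL.
have ti0 : t i0 = s i by rewrite permM tpermR.
have irest : (i != r) && (i != i0) by rewrite ir.
rewrite (bigD1 i) //= [X in _ = X + _](bigD1 i) //= ti ti0 addrAC -addrA addrCA.
rewrite addrA addrAC; congr (_ + _ + _).
apply: eq_bigr => k /andP[/andP[_ ki0] ki].
by rewrite permM tpermD // eq_sym.
Qed.

Lemma exists_kernel_vector : exists x, kernel_vector setT x.
Proof.
(* The repeated condition matches [tperm_cost] at [i0 := r]; the fiberwise minima of [c] are the
   maximal minors. *)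
pose c (s : {perm T}) := \sum_(k | (k != r) && (k != r)) N k (s k).
have [x xP] := attained_twice_fibers predT (fun s : {perm T} => s r) c.
exists x => i ir.
have -> : setT = [set (s : {perm T}) r | s in predT].
  by apply/setP => l; rewrite inE; apply/esym/imsetP; exists (tperm r l); rewrite ?tpermL.
have [s _ s_min] :=
  @arg_minP _ _ _ (1%g : {perm T}) predT (fun s => c s + N i (s r)) isT.
apply: (xP _ s (tperm i r * s)%g) => //.
- by rewrite permM tpermR (inj_eq perm_inj) eq_sym.
- by move=> u _; rewrite /c tperm_cost //; apply: s_min.
Qed.

Lemma singular_kernel_vector (s t : {perm T}) :
    s != t -> s r = t r -> cost t <= cost s ->
    (forall u : {perm T}, u r = s r -> cost s <= cost u) ->
  exists (S : {set T}) x, S \proper setT /\ kernel_vector S x.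
Proof.
move=> st str ts s_min.
have [i0 i0P] : exists i0, s i0 != t i0.
  apply/existsP; rewrite -negb_forall; apply: contra st => /forallP st.
  by apply/eqP/permP => i; apply/eqP.
have i0r : i0 != r by apply: contra i0P => /eqP->; rewrite str.
(* With column [s r] deleted, row [i0] takes over the part of the dummy row. *)
pose P := [pred u : {perm T} | u r == s r].
pose c (u : {perm T}) := \sum_(k | (k != r) && (k != i0)) N k (u k).
have costE u : cost u = c u + N i0 (u i0).
  by rewrite /cost (bigD1 i0) //= addrC.
have [x xP] := attained_twice_fibers P (fun u : {perm T} => u i0) c.
exists [set (u : {perm T}) i0 | u in P], x; split.
  apply/properP; split; first exact: subsetT.
  exists (s r) => //; apply/imsetP => -[u /eqP <- /perm_inj ri0].
  by rewrite ri0 eqxx in i0r.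
(* For row [i0] itself the objective is [cost], and the two minimizers are [s] and [t]; any other
   row uses the row swap. *)
move=> i ir; have [->|ii0] := eqVneq i i0.
  apply: (xP _ s t) => //; rewrite ?inE ?str //.
    by move=> u /eqP ur; rewrite -!costE s_min.
  by move=> u /eqP ur; rewrite -!costE (le_trans ts) ?s_min.
have Ps : P s by rewrite /= eqxx.
have [w Pw w_min] := @arg_minP _ _ _ s P (fun u => c u + N i (u i0)) Ps.
apply: (xP _ w (tperm i i0 * w)%g) => //.
- by rewrite inE permM tpermD //; apply: Pw.
- by rewrite permM tpermR (inj_eq perm_inj) eq_sym.
- by move=> u Pu; rewrite /c tperm_cost //; apply: w_min.
Qed.

Lemma sum_perm_neq (x : T -> R) (s : {perm T}) :
  \sum_(i | i != r) x (s i) = \sum_i x i - x (s r).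
Proof.
rewrite [X in _ = X - _](reindex_inj (@perm_inj _ s)) /= [X in _ = X - _](bigD1 r) //=.
by rewrite addrAC subrr add0r.
Qed.

(** Each row [i != r] asks for a minimizing column other than [s i], and row [r] asks for [k].
    Granting these wishes along a closed set of rows does not increase [cost s - x (s r)]; the
    alternatives tell whether [r] belongs to that set. *)
Lemma exchange (x : T -> R) (s : {perm T}) (k : T) : kernel_vector setT x ->
  (exists t, [/\ s != t, s r = t r & cost t <= cost s]) \/
  (exists t : {perm T}, t r = k /\ cost t - x k <= cost s - x (s r)).
Proof.
move=> xK.
have /fin_all_exists[c cP] : forall i, exists l, if i == r then l = k else
    l != s i /\ forall m, x l + N i l <= x m + N i m.
  move=> i; case: eqVneq => [_|ir]; first by exists k.
  have [l [m [_ _ lm l_min m_min]]] := xK i ir.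
  have [ls|ls] := eqVneq l (s i).
    by exists m; split=> [|n]; [rewrite -ls eq_sym | apply: m_min; rewrite inE].
  by exists l; split=> // n; apply: l_min; rewrite inE.
(* The map sends a row to the row that holds its wanted column under [s]. *)
have [O [q [O0 qP]]] := perm_of_fun (fun i => (s^-1)%g (c i)) r.
pose t := (q * s)%g.
have tE i : t i = if i \in O then c i else s i.
  by rewrite permM qP; case: ifP; rewrite // permKV.
have t_le : cost t - x (t r) <= cost s - x (s r).
  (* Adding the total of [x] to both sides makes the comparison row by row. *)
  suff : \sum_(i | i != r) (x (t i) + N i (t i)) <=
         \sum_(i | i != r) (x (s i) + N i (s i)).
    by rewrite !big_split /= !sum_perm_neq -/(cost t) -/(cost s); lra.
  apply: ler_sum => i ir; rewrite tE; case: ifP => // _.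
  by have := cP i; rewrite (negPf ir) => -[_]; apply.
have [Or|Or] := boolP (r \in O).
  by right; exists t; move: t_le; rewrite tE Or; have := cP r; rewrite eqxx => ->.
left; exists t; move: t_le; rewrite tE (negPf Or) lerD2r => t_le; split=> //.
case/set0Pn: O0 => i Oi; apply/eqP => st.
have ir : i != r by apply: contraNneq Or => <-.
by have := cP i; rewrite (negPf ir) st tE Oi eqxx => -[].
Qed.

Lemma kernel_vector_unique (x y : T -> R) :
    (forall (S : {set T}) z, S \proper setT -> ~ kernel_vector S z) ->
    kernel_vector setT x -> kernel_vector setT y ->
  exists c, forall l, x l = y l + c.
Proof.
move=> no_proper.
have /fin_all_exists[s sP] : forall j, exists s : {perm T},
    s r = j /\ forall u : {perm T}, u r = j -> cost s <= cost u.
  move=> j; pose P := [pred u : {perm T} | u r == j].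
  have P1 : P (tperm r j) by rewrite /= tpermL.
  have [w /eqP wj w_min] := @arg_minP _ _ _ (tperm r j) P cost P1.
  by exists w; split=> // u /eqP; apply: w_min.
(* By symmetry in [j] and [k], [cost (s j) - z j] is independent of [j], so [z] is the Cramer vector
   up to a constant. A second optimal permutation would give a solution on fewer columns. *)
have cramer z : kernel_vector setT z -> forall j k,
    cost (s k) - z k <= cost (s j) - z j.
  move=> zK j k; have [sj sj_min] := sP j; have [_ sk_min] := sP k.
  case: (exchange (s j) k zK) => [[t [st str ts]]|[t [/sk_min tk tz]]].
    have [|S [w [SP wK]]] := singular_kernel_vector st str ts.
      by move=> u; rewrite sj; apply: sj_min.
    by case: (no_proper _ _ SP wK).
  by rewrite sj in tz; apply: le_trans tz; rewrite lerD2r.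
move=> xK yK; exists (x r - y r) => l.
have := cramer x xK r l; have := cramer x xK l r.
have := cramer y yK r l; have := cramer y yK l r; lra.
Qed.

Lemma kernel_vector_extend (S : {set T}) (z : T -> R) : kernel_vector S z ->
  (exists i, i != r) -> S \proper setT ->
  exists x y, [/\ kernel_vector setT x, kernel_vector setT y &
    ~ exists c, forall l, x l = y l + c].
Proof.
move=> zK [i1 i1r] /properP[_ [j0 _ j0S]].
(* The row [i1] ensures that [S] has an element [e], against which the other columns are bounded. *)
have [e [_ [eS _ _ _ _]]] := zK i1 i1r.
pose m := \sum_i \sum_l `|z e + N i e - N i l|.
have m_ge i l : z e + N i e <= m + N i l.
  rewrite -lerBlDr; apply: le_trans (ler_norm _) _.
  rewrite /m (bigD1 i) //= (bigD1 l) //= -[leRHS]addrA lerDl addr_ge0 ?sumr_ge0 //.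
  by move=> k _; apply: sumr_ge0.
(* For [d >= 0] the new columns never go below the minimum over [S]; the choices 0 and 1 agree on
   [S] but differ off it. *)
pose x d l := if l \in S then z l else m + d.
have xK d : 0 <= d -> kernel_vector setT (x d).
  move=> d0 i ir; have [j [k [jS kS jk j_min k_min]]] := zK i ir.
  have ext n : n \in S -> (forall l, l \in S -> z n + N i n <= z l + N i l) ->
      forall l, l \in setT -> x d n + N i n <= x d l + N i l.
    move=> nS n_min l _; rewrite /x nS; case: ifP => [|_]; first exact: n_min.
    by apply: le_trans (n_min _ eS) (le_trans (m_ge i l) _); rewrite lerD2r lerDl.
  by exists j, k; split; rewrite ?inE //; apply: ext.
exists (x 0), (x 1); split; [exact: xK|exact: xK|].
by move=> [c xc]; have := xc e; have := xc j0; rewrite /x eS (negPf j0S); lra.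
Qed.

End TropicalKernel.

(** * Conics through five points as kernel vectors *)

Section ConicBridge.
Local Open Scope ring_scope.
Variable R : realType.

Definition conic_monomial (u : 'rV[R]_3) (j : 'I_6) : R :=
  \sum_(k < 3) (tnth (tnth conic_exponents j) k)%:R * u 0 k.

Definition conic_index (e : exponent) : 'I_6 := inord (index e conic_exponents).

Lemma conic_indexK : {in conic_support, cancel conic_index (tnth conic_exponents)}.
Proof.
move=> e; rewrite in_conic_support => eC.
rewrite (tnth_nth [tuple 0; 0; 0]%N) inordK ?nth_index //.
by rewrite -index_mem in eC.
Qed.

Lemma tnth_conicK : cancel (tnth conic_exponents) conic_index.
Proof.
move=> j; apply: (elimT (tuple_uniqP conic_exponents) isT).
by rewrite conic_indexK // in_conic_support mem_tnth.
Qed.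

(** Describing [b] as part of a vector [x] on all six monomials lets every support share the index
    type ['I_6]. *)
Lemma min_attained_twiceP (B : {fset exponent}) (b : B -> R) (x : 'I_6 -> R) u :
    (B `<=` conic_support)%fset ->
    (forall e : B, b e = x (conic_index (val e))) ->
  min_attained_twice b u <->
  attained_twice [set j | tnth conic_exponents j \in B]
    (fun j => x j + conic_monomial u j).
Proof.
move=> /fsubsetP BC bx.
have monoE (e : B) : tropical_monomial (b e) (val e) u =
    x (conic_index (val e)) + conic_monomial u (conic_index (val e)).
  by rewrite /tropical_monomial /conic_monomial conic_indexK ?bx ?BC ?fsvalP.
have idxB (e : B) : conic_index (val e) \in [set j | tnth conic_exponents j \in B].
  by rewrite inE conic_indexK ?BC ?fsvalP.
split=> [/card_gt1P[e [f [eP fP ef]]]|[j [k [jB kB jk j_min k_min]]]].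
  have argminE (g : B) : g \in argmin_terms b u ->
      forall l, l \in [set j | tnth conic_exponents j \in B] ->
      x (conic_index (val g)) + conic_monomial u (conic_index (val g)) <=
      x l + conic_monomial u l.
    rewrite !inE => /forallP gP l; rewrite inE => lB.
    by have := gP [` lB]%fset; rewrite !monoE /= tnth_conicK.
  exists (conic_index (val e)), (conic_index (val f)).
  split; [exact: idxB|exact: idxB| |exact: argminE|exact: argminE].
  apply: contra ef => /eqP /(congr1 (tnth conic_exponents)).
  by rewrite !conic_indexK ?BC ?fsvalP // => /val_inj->.
move: (jB) (kB); rewrite !inE => jB' kB'.
apply/card_gt1P; exists [` jB']%fset, [` kB']%fset; split.
- by rewrite inE; apply/forallP => g; rewrite !monoE /= tnth_conicK j_min ?idxB.
- by rewrite inE; apply/forallP => g; rewrite !monoE /= tnth_conicK k_min ?idxB.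
- by apply: contra jk => /eqP /(congr1 val) /= /(can_inj tnth_conicK)->.
Qed.

Lemma conic_support_setT :
  [set j | tnth conic_exponents j \in conic_support] = setT.
Proof. by apply/setP => j; rewrite !inE in_conic_support mem_tnth. Qed.

(** Row [ord0] is the dummy row that makes the matrix square; the points fill the rows
    [lift ord0 i]. *)
Definition points_matrix (p : 'I_5 -> TP R 2) (t j : 'I_6) : R :=
  if unlift ord0 t is Some i then conic_monomial (TPrepr (p i)) j else 0.

Lemma points_kernelP (p : 'I_5 -> TP R 2) (S : {set 'I_6}) (x : 'I_6 -> R) :
  kernel_vector (points_matrix p) ord0 S x <->
  forall i, attained_twice S (fun j => x j + conic_monomial (TPrepr (p i)) j).
Proof.
split=> [xK i|xK t].
  by have := xK (lift ord0 i) isT; rewrite /points_matrix liftK.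
by rewrite eq_sym => /unlift_some[i -> _]; rewrite /points_matrix liftK; apply: xK.
Qed.

Lemma tropical_curve_kernel (p : 'I_5 -> TP R 2) (B : {fset exponent})
    (b : B -> R) (x : 'I_6 -> R) :
    (B `<=` conic_support)%fset ->
    (forall e : B, b e = x (conic_index (val e))) ->
  (forall i, p i \in tropical_curve b) <->
  kernel_vector (points_matrix p) ord0
    [set j | tnth conic_exponents j \in B] x.
Proof.
move=> BC bx; rewrite points_kernelP.
by split=> H i; have := H i; rewrite (min_attained_twiceP _ BC bx).
Qed.

Lemma tropical_conic_kernel (p : 'I_5 -> TP R 2) (a : 'rV[R]_6) :
  (forall i, p i \in tropical_conic (TPclass a)) <->
  kernel_vector (points_matrix p) ord0 setT (a 0).
Proof.
rewrite -conic_support_setT.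
rewrite -(@tropical_curve_kernel p _ (conic_coef a)) ?fsubset_refl //.
  by split=> H i; have := H i; rewrite -[p i]TPreprK tropical_conic_class
    (tropical_curve_class _ _ homogeneous_conic_support).
move=> e; congr (a 0 _); apply: val_inj.
by rewrite /= inordK // conic_indexP.
Qed.

End ConicBridge.

Theorem corollary5p6 (R : realType) (p : 'I_5 -> TP R 2) :
  (exists a : TP R 5, forall i : 'I_5, p i \in tropical_conic a) /\
  ((exists! a : TP R 5, forall i : 'I_5, p i \in tropical_conic a) <->
   ~ (exists (B : {fset exponent}) (b : B -> R),
        (B `<` conic_support)%fset /\
        (forall i : 'I_5, p i \in tropical_curve b))).
Proof.
have row_kernel x : kernel_vector (points_matrix p) ord0 setT x ->
    forall i, p i \in tropical_conic (TPclass (\row_j x j)%R).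
  move=> xK; apply/tropical_conic_kernel => i ir.
  have [j [k [jS kS jk j_min k_min]]] := xK i ir.
  by exists j, k; split=> // l lS; rewrite !mxE ?j_min ?k_min.
have [x xK] := exists_kernel_vector (points_matrix p) ord0.
have conicP := row_kernel x xK.
split; first by exists (TPclass (\row_j x j)%R).
split=> [[a [_ a_uniq]] [B [b [BC bP]]]|no_proper].
  (* Extend [b] by 0 outside [B]. *)
  pose z j := oapp b 0%R (insub (tnth conic_exponents j)).
  have bz (e : B) : b e = z (conic_index (val e)).
    by rewrite /z conic_indexK ?valK //; apply: (fsubsetP (fproper_sub BC)); apply: fsvalP.
  have zK := (tropical_curve_kernel p (fproper_sub BC) bz).1 bP.
  have [||y [w [yK wK yw]]] := kernel_vector_extend zK.
  - by exists (lift ord0 ord0).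
  - apply/properP; split; first exact: subsetT.
    move: BC; rewrite fproperE => /andP[_ /fsubsetPn[e eC eB]]; exists (conic_index e) => //.
    by rewrite inE conic_indexK.
  have := a_uniq _ (row_kernel y yK); rewrite (a_uniq _ (row_kernel w wK)).
  move=> /esym /TPclass_eqP[c ywc]; apply: yw; exists c => l.
  by have /rowP/(_ l) := ywc; rewrite !mxE.
exists (TPclass (\row_j x j)%R); split=> // a.
rewrite -[a]TPreprK => /tropical_conic_kernel aK.
have [|c xc] := kernel_vector_unique _ xK aK; last first.
  by apply/TPclass_eqP; exists c; apply/rowP => j; rewrite !mxE xc.
(* A kernel vector on a proper set of columns is a curve through the points supported on the
   corresponding monomials. *)
move=> S z SP zK; apply: no_proper.
pose B := [fset tnth conic_exponents j | j in S]%fset.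
have BE j : (tnth conic_exponents j \in B) = (j \in S).
  apply/imfsetP/idP => [[k kS /(can_inj (tnth_conicK))->]//|jS].
  by exists j.
have BC : (B `<=` conic_support)%fset.
  by apply/fsubsetP => e /imfsetP[j _ ->]; rewrite in_conic_support mem_tnth.
exists B, (fun e => z (conic_index (val e))); split.
  case/properP: SP => _ [j _ jS]; rewrite fproperE BC; apply/fsubsetPn.
  by exists (tnth conic_exponents j); rewrite ?BE // in_conic_support mem_tnth.
apply/(@tropical_curve_kernel _ p B _ z) => //.
by have -> : [set j | tnth conic_exponents j \in B] = S by apply/setP => j; rewrite inE BE.
Qed.
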